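(* For each integer $r\ge 3$, define $s_r:=\lfloor\log_2 r\rfloor-1$. Then $$1-\mu\big(r,0,(AB)^{s_r}B^{r-2}\big)\sim\frac{2s_r}{r}\quad\text{as } r\to\infty,$$ assuming initial capital is even if $r$ is even, where $\mu(r,0,(AB)^sB^{r-2})$ is the rate of profit defined in the context.
   Context: Here $a_r\sim b_r$ as $r\to\infty$ means $a_r/b_r\to 1$. A $p$-coin is a coin with probability $p$ of heads. A player has an integer-valued capital; in each game the player wins one unit with heads and loses one unit with tails. In game $A$ a fair coin is tossed. In game $B$ (with integer parameter $r\ge3$ and real parameter $\rho\in[0,1)$) a $p_0$-coin is tossed if the current capital is a multiple of $r$, and a $p_1$-coin otherwise, where $p_0=\rho^{r-1}/(1+\rho^{r-1})$ and $p_1=1/(1+\rho)$. Here $\rho=0$, so $p_0=0$ and $p_1=1$: in game $B$ the player surely loses one unit if capital is a multiple of $r$ and surely wins one unit otherwise. All coin tosses are independent. The pattern $(AB)^sB^{r-2}$ is the finite word of games consisting of $s$ copies of $AB$ (game $A$, then game $B$) followed by $r-2$ plays of game $B$, of total length $2s+r-2$; the games are played in the order of this word, repeated ad infinitum. If $S_n$ denotes the cumulative profit (current capital minus initial capital) after $n$ games, the rate of profit $\mu(r,0,(AB)^sB^{r-2})$ is the constant to which $n^{-1}S_n$ converges almost surely as $n\to\infty$. When $r$ is odd this does not depend on initial capital; when $r$ is even it depends on the parity of the initial capital, which is taken to be even. *)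

(* Defs.v *)
From HB Require Import structures.
From mathcomp Require Import all_boot all_order all_algebra.
From mathcomp Require Import all_classical all_reals all_analysis.

Set Implicit Arguments.
Unset Strict Implicit.
Unset Printing Implicit Defensive.

Import Order.TTheory GRing.Theory Num.Theory.
Import numFieldNormedType.Exports.

Local Open Scope classical_set_scope.
Local Open Scope ring_scope.

Inductive game := A | B.

(* Game A tosses [fair]; game B tosses [coin0] when the capital is a multiple
   of r, and [coin1] otherwise. *)
Inductive coin := fair | coin0 | coin1.

Definition coin_prob (R : realType) (r : nat) (rho : R) (c : coin) : R :=
  match c with
  | fair => 1 / 2
  | coin0 => rho ^+ (r - 1) / (1 + rho ^+ (r - 1))
  | coin1 => 1 / (1 + rho)
  end.

(* The injections f range over the finite subfamilies of E. *)
Definition mutually_independent d (T : measurableType d) (R : realType)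
    (P : probability T R) (I : Type) (E : I -> set T) : Prop :=
  (forall i, measurable (E i)) /\
  forall (k : nat) (f : 'I_k -> I), injective f ->
    P (\bigcap_(j : 'I_k) E (f j)) = (\prod_(j < k) P (E (f j)))%E.

(* [heads c n] is the event that the n-th toss (n = 0, 1, ...) of the coin c
   comes up heads. *)
Definition independent_tosses d (T : measurableType d) (R : realType)
    (P : probability T R) (r : nat) (rho : R)
    (heads : coin -> nat -> set T) : Prop :=
  mutually_independent P (fun i : coin * nat => heads i.1 i.2) /\
  forall c n, P (heads c n) = (coin_prob r rho c)%:E.

Definition coin_of (r : nat) (g : game) (x : int) : coin :=
  match g with
  | A => fair
  | B => if (r%:Z %| x)%Z then coin0 else coin1
  end.

(* The n-th game played (n = 0, 1, ...) when the word w is repeated forever;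
   the default value B is only reached for the empty word. *)
Definition game_at (w : seq game) (n : nat) : game := nth B w (n %% size w)%N.

(* Capital after n games.  One coin only is tossed in game n, and its outcome
   is the n-th toss of that coin; the n-th tosses of the others are ignored. *)
Fixpoint capital (T : Type) (r : nat) (heads : coin -> nat -> set T)
    (w : seq game) (x0 : int) (n : nat) (t : T) : int :=
  match n with
  | 0%N => x0
  | m.+1 => let x := capital r heads w x0 m t in
            if t \in heads (coin_of r (game_at w m) x) m then x + 1 else x - 1
  end.

Definition profit (T : Type) (r : nat) (heads : coin -> nat -> set T)
    (w : seq game) (x0 : int) (n : nat) (t : T) : int :=
  capital r heads w x0 n t - x0.

(* The constant to which the average profit converges almost surely (0 if
   there is none).  The dependence on rho is through the law of [heads]. *)
Definition rate_of_profit d (T : measurableType d) (R : realType)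
    (P : probability T R) (r : nat) (heads : coin -> nat -> set T)
    (w : seq game) (x0 : int) : R :=
  xget 0 [set m : R | {ae P, forall t : T,
    (fun n : nat => (profit r heads w x0 n t)%:~R / n%:R : R) @ \oo --> m}].

(* (AB)^s B^(r-2) *)
Definition pattern (s r : nat) : seq game :=
  flatten (nseq s [:: A; B]) ++ nseq (r - 2) B.

Definition s_ (r : nat) : nat := (trunc_log 2 r - 1)%N.

(* Main.v *)
Require Import Defs.
From mathcomp Require Import all_boot all_order all_algebra.
From mathcomp Require Import all_classical all_reals all_analysis.
From mathcomp Require Import measurable_realfun.
From mathcomp Require Import zify ring lra.
Import Order.TTheory GRing.Theory Num.Theory.
Import numFieldNormedType.Exports.
Local Open Scope classical_set_scope.
Local Open Scope ring_scope.

(* Almost surely only the fair tosses are random.  Write L = 2s + r - 2 for the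
   length of the pattern and q = 2^-s for the probability that all the tosses
   of game A in a period are tails.  If 2s < r, then after one period the
   capital is a multiple of r, or (only if r is odd) one below a multiple of r.
   From a multiple of r, the block (AB)^s adds twice the number of heads; the
   r - 2 plays of B then lead to the next multiple of r if there was at least
   one head, and otherwise end at the same multiple (r even) or one below it
   (r odd).  From one below a multiple of r, a period always ends at that
   multiple.  Hence the capital is a functional of a two-state chain driven by
   independent events of probability q.  The empirical frequencies follow from
   a strong law for the martingale of the discrepancies Z_k (xi_k - q), where
   Z_k indicates the first state and xi_k the event: its second moments are at
   most linear, so it vanishes on average along the squares, hence everywhere.
   With c = 1 for r odd and c = 0 for r even, this gives
   mu = r (1 - q) / ((1 + c q) L).  For s = s_r one has 2 <= r q < 4 and
   s^2 <= r, which bounds the relative error in 1 - mu ~ 2s / r by 11 / s. *)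

Set Implicit Arguments.
Unset Strict Implicit.
Unset Printing Implicit Defensive.

(** * A strong law from linearly growing second moments *)

(** For x >= 1 one has 1 / x^2 <= 2 / (x (x + 1)), and the right-hand side telescopes. *)
Lemma sum_inv_squares_le (R : realType) (n : nat) :
  \sum_(k < n) (k.+1%:R ^+ 2 : R)^-1 <= 2 - 2 / n.+1%:R.
Proof.
elim: n => [|n IH]; first by rewrite big_ord0 divr1 subrr.
rewrite big_ord_recr /=; apply: (le_trans (lerD IH (lexx _))).
have n0 : 0 < n.+1%:R :> R by rewrite ltr0n.
have -> : n.+2%:R = n.+1%:R + 1 :> R by rewrite -natr1.
set x := n.+1%:R in n0 *.
have x1 : 1 <= x by rewrite /x ler1n.
rewrite -subr_ge0.
have -> : 2 - 2 / (x + 1) - (2 - 2 / x + (x ^+ 2)^-1) =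
          (x - 1) / (x ^+ 2 * (x + 1)) by field; apply/andP; split; lra.
by rewrite divr_ge0 ?subr_ge0// mulr_ge0 ?exprn_ge0//; lra.
Qed.

Lemma exists_square_bracket (N : nat) :
  exists n, (n ^ 2 <= N < n.+1 ^ 2)%N.
Proof.
elim: N => [|N [n /andP[h1 h2]]]; first by exists 0%N.
have [h|h] := ltnP N.+1 (n.+1 ^ 2)%N; first by exists n; rewrite h andbT; lia.
by exists n.+1; lia.
Qed.

(** Between n^2 and (n + 1)^2 the sequence moves by at most 2n, which is negligible against n^2. *)
Lemma cvg0_of_squares (R : realType) (u : nat -> R) :
  (forall n, `|u n.+1 - u n| <= 1) ->
  (fun n => u (n ^ 2)%N / (n ^ 2)%:R) @ \oo --> (0 : R) ->
  (fun n => u n / n%:R) @ \oo --> (0 : R).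
Proof.
move=> du cu.
have lip m k : `|u (m + k)%N - u m| <= k%:R.
  elim: k => [|k IH]; first by rewrite addn0 subrr normr0.
  rewrite addnS -(subrKA (u (m + k)%N)) -natr1 addrC.
  rewrite (addrC k%:R) (le_trans (ler_normD _ _))// addrC lerD//.
apply/cvgrPdist_le => e e0.
move/cvgrPdist_le: cu => /(_ (e / 2)); rewrite divr_gt0// => /(_ isT)[K _ HK].
have [M HM] : exists M : nat, 4 / e <= M%:R.
  by exists (Num.trunc (4 / e)).+1; rewrite ltW// truncnS_gt.
exists ((K + M + 1) ^ 2)%N => // N /= hN; rewrite sub0r normrN.
have [n /andP[n1 n2]] := exists_square_bracket N.
have nK : (K + M + 1 <= n)%N.
  by rewrite -ltnS -(@ltn_exp2r _ _ 2)// (leq_ltn_trans hN).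
have := HK n (leq_trans (leq_addr _ _) (leq_trans (leq_addr _ _) nK)).
rewrite sub0r normrN !normrM !normfV !normr_nat => h.
have n0 : 0 < (n ^ 2)%:R :> R by rewrite ltr0n; lia.
have N0 : 0 < N%:R :> R by rewrite ltr0n; lia.
move: h; rewrite ler_pdivrMr// => h.
rewrite ler_pdivrMr//.
have hu : `|u N| <= `|u (n ^ 2)%N| + (2 * n)%:R.
  have -> : N = (n ^ 2 + (N - n ^ 2))%N by lia.
  rewrite -{1}(subrK (u (n ^ 2)%N) (u _)) addrC.
  apply: (le_trans (ler_normD _ _)); rewrite lerD2l.
  by apply: (le_trans (lip _ _)); rewrite ler_nat; lia.
apply: (le_trans hu).
have h3 : (2 * n)%:R <= e / 2 * (n ^ 2)%:R :> R.
  have : 4 <= e * n%:R.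
    rewrite mulrC -ler_pdivrMr// (le_trans HM)// ler_nat; lia.
  rewrite natrM natrX; have : 0 <= n%:R :> R by []. 
  move: n%:R => x; nra.
have h4 : (n ^ 2)%:R <= N%:R :> R by rewrite ler_nat.
nra.
Qed.

Section strong_law.
Context d (T : measurableType d) (R : realType) (P : probability T R).

(** Along the squares, the second moments of the averages are at most 1 / n^2. Their series thus has
    a finite integral, so almost surely the series of squared averages converges and its terms
    vanish. *)
Lemma ae_cvg0_of_second_moments (S : nat -> T -> R) :
  (forall n, measurable_fun setT (S n)) ->
  (forall n t, `|S n.+1 t - S n t| <= 1) ->
  (forall n, (\int[P]_t ((S n t) ^+ 2)%:E <= n%:R%:E)%E) ->
  {ae P, forall t, (fun n => S n t / n%:R) @ \oo --> (0 : R)}.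
Proof.
move=> mS dS S2.
pose u n t := (S (n.+1 ^ 2)%N t / (n.+1 ^ 2)%:R) ^+ 2.
have u0 n t : (0 <= (u n t)%:E)%E by rewrite lee_fin sqr_ge0.
have mu n : measurable_fun setT (u n).
  by apply: measurable_funX; apply: measurable_funM.
have meu n : measurable_fun setT (fun t => (u n t)%:E) by apply/measurable_EFinP.
have iu n : (\int[P]_t (u n t)%:E <= ((n.+1%:R ^+ 2)^-1)%:E)%E.
  rewrite (eq_integral (fun t =>
    ((((n.+1 ^ 2)%:R ^+ 2)^-1)%:E * ((S (n.+1 ^ 2)%N t) ^+ 2)%:E)%E)); last first.
    by move=> t _; rewrite -EFinM /u expr_div_n mulrC.
  rewrite ge0_integralZl ?lee_fin ?invr_ge0 ?sqr_ge0//; last first.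
  - by move=> t _; rewrite lee_fin sqr_ge0.
  - by apply/measurable_EFinP; apply: measurable_funX.
  apply: (le_trans (lee_wpmul2l _ (S2 _))); first by rewrite lee_fin invr_ge0 sqr_ge0.
  by rewrite -EFinM lee_fin natrX expr2 invfM -mulrA mulVf ?mulr1// expf_neq0// pnatr_eq0.
have itg : P.-integrable setT (fun t => (\sum_(n <oo) (u n t)%:E)%E).
  apply/integrableP; split.
    by apply: ge0_emeasurable_sum.
  rewrite (eq_integral (fun t => (\sum_(n <oo) (u n t)%:E)%E)); last first.
    by move=> t _; rewrite gee0_abs//; apply: nneseries_ge0.
  rewrite integral_nneseries//.
  apply: (@le_lt_trans _ _ 2%:E); last by rewrite ltry.
  apply: lime_le; first by apply: is_cvg_nneseries => n _ _; apply: integral_ge0.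
  apply: nearW => n.
  apply: (le_trans (lee_sum _ (fun i _ => iu i))).
  rewrite sumEFin lee_fin big_mkord (le_trans (sum_inv_squares_le R n))//.
  by rewrite gerBl// divr_ge0.
apply: filterS (integrable_ae measurableT itg) => t /(_ I) fint.
apply: cvg0_of_squares => //.
have cs : cvgn (series (u ^~ t)).
  apply: nondecreasing_is_cvgn.
    by apply: nondecreasing_series => n _ _; rewrite -lee_fin.
  exists (fine (\sum_(n <oo) (u n t)%:E)%E) => _ [n _ <-].
  rewrite -lee_fin fineK// /series/= -sumEFin.
  by apply: nneseries_lim_ge => k _.
have h : (fun n => Num.sqrt (u n t)) @ \oo --> (Num.sqrt 0 : R).
  apply: (@continuous_cvg _ _ _ _ _ _ (@Num.sqrt R)); first exact: sqrt_continuous.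
  exact: cvg_series_cvg_0 cs.
apply/norm_cvg0P; rewrite -cvg_shiftS/=.
move: h; rewrite sqrtr0; apply: cvg_trans.
apply: near_eq_cvg; apply: nearW => n /=.
by rewrite /u sqrtr_sqr.
Qed.

End strong_law.

(** * Runs of tails and their independence of the past *)

(** The stride 2 is that of game A in a block of copies of AB starting at time [n]. *)
Definition all_tails (h : nat -> bool) (n m : nat) : bool :=
  [forall i : 'I_m, ~~ h (n + 2 * i)%N].

Lemma all_tails0 h n : all_tails h n 0.
Proof. by apply/forallP => -[]. Qed.

Lemma all_tailsS h n m :
  all_tails h n m.+1 = all_tails h n m && ~~ h (n + 2 * m)%N.
Proof.
apply/forallP/andP => [hh|[/forallP h1 h2] i].
  split; last exact: (hh ord_max).
  by apply/forallP => i; exact: (hh (widen_ord (leqnSn m) i)).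
have [im|mi] := ltnP i m; first exact: (h1 (Ordinal im)).
by rewrite (_ : nat_of_ord i = m)//; have := ltn_ord i; lia.
Qed.

Section future_independence.
Context d (T : measurableType d) (R : realType) (P : probability T R).
Variables (H : nat -> set T) (p : R).
Hypothesis mH : forall n, measurable (H n).
Hypothesis indep : forall l : seq nat, uniq l ->
  \int[P]_t (\prod_(i <- l) \1_(H i) t) = p ^+ size l.

Implicit Types W : T -> R.

Lemma Rintegral_probability_cst c : \int[P]_t c = c :> R.
Proof.
rewrite Rintegral_cst//; have /= PT := @probability_setT _ _ _ P.
by rewrite [X in fine X](_ : _ = 1%E) ?mulr1.
Qed.

Definition bounded_measurable W :=
  measurable_fun setT W /\ exists M, forall t, `|W t| <= M.

Lemma bounded_measurable_integrable W :
  bounded_measurable W -> P.-integrable setT (EFin \o W).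
Proof.
move=> [mW [M WM]]; apply: measurable_bounded_integrable => //.
  by rewrite (le_lt_trans (probability_le1 _ _))// ltry.
by exists M; split; [exact: num_real|move=> x Mx t _; exact: le_trans (WM t) (ltW Mx)].
Qed.

Lemma bounded_measurable_cst c : bounded_measurable (fun=> c).
Proof. by split; [exact: measurable_cst|exists `|c|]. Qed.

Lemma bounded_measurableD W1 W2 : bounded_measurable W1 ->
  bounded_measurable W2 -> bounded_measurable (fun t => W1 t + W2 t).
Proof.
move=> [m1 [M1 h1]] [m2 [M2 h2]]; split; first exact: measurable_funD.
by exists (M1 + M2) => t; rewrite (le_trans (ler_normD _ _))// lerD.
Qed.

Lemma bounded_measurableM W1 W2 : bounded_measurable W1 ->
  bounded_measurable W2 -> bounded_measurable (fun t => W1 t * W2 t).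
Proof.
move=> [m1 [M1 h1]] [m2 [M2 h2]]; split; first exact: measurable_funM.
by exists (M1 * M2) => t; rewrite normrM ler_pM.
Qed.

Lemma bounded_measurable_indic n : bounded_measurable (\1_(H n)).
Proof.
split; first exact: measurable_indic.
by exists 1 => t; rewrite indicE; case: (_ \in _); rewrite ?normr0 ?normr1.
Qed.

Lemma bounded_measurable_prod (l : seq nat) :
  bounded_measurable (fun t => \prod_(i <- l) \1_(H i) t).
Proof.
elim: l => [|i l IH].
  rewrite (_ : (fun _ => _) = fun=> 1); first exact: bounded_measurable_cst.
  by apply/funext => t; rewrite big_nil.
rewrite (_ : (fun _ => _) = fun t => \1_(H i) t * \prod_(j <- l) \1_(H j) t).
  exact: bounded_measurableM (bounded_measurable_indic i) IH.
by apply/funext => t; rewrite big_cons.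
Qed.

(* [future_indep n W] replaces "W is a function of the first n tosses": it
   keeps the only consequence of adaptedness that is needed, and it is
   visibly preserved by the operations that build W. *)
Definition future_indep n W := bounded_measurable W /\
  forall l : seq nat, uniq l -> all (leq n) l ->
  \int[P]_t (W t * \prod_(i <- l) \1_(H i) t) = \int[P]_t W t * p ^+ size l.

Lemma future_indep_cst n c : future_indep n (fun=> c).
Proof.
split=> [|l ul _]; first exact: bounded_measurable_cst.
rewrite RintegralZl//; last first.
  exact/bounded_measurable_integrable/bounded_measurable_prod.
by rewrite indep// Rintegral_probability_cst.
Qed.

Lemma future_indepD n W1 W2 : future_indep n W1 -> future_indep n W2 ->
  future_indep n (fun t => W1 t + W2 t).
Proof.
move=> [b1 f1] [b2 f2]; split=> [|l ul al]; first exact: bounded_measurableD.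
have bp := bounded_measurable_prod l.
under eq_Rintegral do rewrite mulrDl.
by rewrite !RintegralD//; try (by apply: bounded_measurable_integrable;
  rewrite //; apply: bounded_measurableM); rewrite f1// f2// mulrDl.
Qed.

Lemma future_indepZ n c W : future_indep n W -> future_indep n (fun t => c * W t).
Proof.
move=> [b f]; split=> [|l ul al].
  exact: bounded_measurableM (bounded_measurable_cst c) b.
under eq_Rintegral do rewrite -mulrA.
rewrite !RintegralZl// ?f ?mulrA//; apply: bounded_measurable_integrable => //.
exact: bounded_measurableM b (bounded_measurable_prod l).
Qed.

Lemma future_indepB n W1 W2 : future_indep n W1 -> future_indep n W2 ->
  future_indep n (fun t => W1 t - W2 t).
Proof.
move=> f1 /(future_indepZ (-1)) f2; have := future_indepD f1 f2.
by under eq_fun do rewrite mulN1r.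
Qed.

Lemma future_indep_le m n W : (m <= n)%N -> future_indep m W -> future_indep n W.
Proof.
move=> mn [b f]; split=> // l ul al; apply: f => //.
by apply: sub_all al => i; exact: leq_trans.
Qed.

Lemma Rintegral_future n W : future_indep n W ->
  \int[P]_t (W t * \1_(H n) t) = p * \int[P]_t W t.
Proof.
move=> [_ /(_ [:: n] isT)]; rewrite /= leqnn => /(_ isT).
by under eq_Rintegral do rewrite big_seq1; rewrite mulrC.
Qed.

(** Toss [n] is used up: adding [n] to a list of later indices keeps it free of duplicates, so the
    assumption on [W] applies to [n :: l]. *)
Lemma future_indepM n W : future_indep n W ->
  future_indep n.+1 (fun t => W t * \1_(H n) t).
Proof.
move=> fW; have [b f] := fW; split=> [|l ul al].
  exact: bounded_measurableM b (bounded_measurable_indic n).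
rewrite (Rintegral_future fW).
have := f (n :: l); rewrite /= leqnn ul andbT.
have -> : n \notin l by apply/negP => /(allP al); rewrite ltnn.
have -> : all (leq n) l by apply: sub_all al => i; exact: ltnW.
move=> /(_ isT isT); under eq_Rintegral do rewrite big_cons mulrA.
by move=> ->; rewrite exprS mulrA (mulrC p).
Qed.

Let tails n m t := all_tails (fun i => t \in H i) n m.

(** Multiplying by the indicator of a tail is subtracting the product with the indicator of a head,
    so each toss contributes a factor [1 - p]. *)
Lemma future_indep_all_tails n m W : future_indep n W ->
  future_indep (n + 2 * m) (fun t => W t * (tails n m t)%:R) /\
  \int[P]_t (W t * (tails n m t)%:R) = (1 - p) ^+ m * \int[P]_t W t.
Proof.
move=> fW; elim: m => [|m [IH1 IH2]].
  have -> : (fun t => W t * (tails n 0 t)%:R) = W.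
    apply/funext => t; by rewrite /tails all_tails0 mulr1.
  by rewrite muln0 addn0 expr0 mul1r.
set V := fun t => _ in IH1.
have -> : (fun t => W t * (tails n m.+1 t)%:R) =
          (fun t => V t - V t * \1_(H (n + 2 * m)) t).
  apply/funext => t; rewrite /V /tails all_tailsS indicE.
  by case: (all_tails _ _ _); case: (t \in _); rewrite /=; ring.
have bV := IH1.1; have bh := bounded_measurable_indic (n + 2 * m).
split.
  apply: (@future_indep_le (n + 2 * m).+1); first lia.
  by apply: future_indepB; [exact: future_indep_le IH1|exact: future_indepM].
rewrite RintegralB//; try (by apply: bounded_measurable_integrable;
  rewrite //; apply: bounded_measurableM).
by rewrite (Rintegral_future IH1) IH2 exprS; ring.
Qed.

Variables (s L : nat).
Hypothesis sL : (2 * s <= L)%N.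

(** The shift by one skips period 0, whose starting capital is arbitrary. *)
Definition period_tails k (t : T) : bool := tails (k.+1 * L) s t.

Let q := (1 - p) ^+ s.

Lemma future_indep_period k W : future_indep (k.+1 * L) W ->
  future_indep (k.+2 * L) (fun t => W t * (period_tails k t)%:R) /\
  \int[P]_t (W t * (period_tails k t)%:R) = q * \int[P]_t W t.
Proof.
move=> /(future_indep_all_tails s)[h1 h2]; split=> //.
by apply: future_indep_le h1; rewrite (mulSn k.+1) addnC leq_add2r.
Qed.

End future_independence.

(* [chain c b xi k] is false in the state where the capital is one below a
   multiple of r: that state is entered when xi holds (only if c holds), and
   left after one step. *)
Fixpoint chain (c b : bool) (xi : nat -> bool) k : bool :=
  if k is k'.+1 then ~~ [&& c, chain c b xi k' & xi k'] else b.

Definition discrepancy (R : realType) (c b : bool) (xi : nat -> bool) (q : R) n : R :=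
  \sum_(k < n) (chain c b xi k)%:R * ((xi k)%:R - q).

(** * The martingale of discrepancies *)

Section discrepancy.
Context d (T : measurableType d) (R : realType) (P : probability T R).
Variables (H : nat -> set T) (p : R).
Hypothesis mH : forall n, measurable (H n).
Hypothesis indep : forall l : seq nat, uniq l ->
  \int[P]_t (\prod_(i <- l) \1_(H i) t) = p ^+ size l.
Variables (s L : nat).
Hypothesis sL : (2 * s <= L)%N.
Hypothesis p01 : 0 <= p <= 1.
Variables (c b : bool).

Let q := (1 - p) ^+ s.
Let X k t := period_tails H s L k t.
Let Z k t : R := (chain c b (X^~ t) k)%:R.
Let S n t := discrepancy c b (X^~ t) q n.

Lemma discrepancyS n t : S n.+1 t = S n t + Z n t * ((X n t)%:R - q).
Proof. by rewrite /S /discrepancy big_ord_recr. Qed.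

Let q01 : 0 <= q <= 1.
Proof. by move/andP: p01 => [p0 p1]; rewrite exprn_ge0 ?exprn_ile1//; lra. Qed.

Lemma discrepancy_step n t : `|S n.+1 t - S n t| <= 1.
Proof.
rewrite discrepancyS addrC addKr normrM /Z; move: q01.
case: (chain _ _ _ _); last by rewrite normr0 mul0r.
by case: (X n t) => ?; rewrite normr1 mul1r ler_norml; apply/andP; split; rewrite /=; lra.
Qed.

(* S_n and Z_n alone would not do: the cross term in the second moment of
   S_(n+1) involves S_n Z_n. *)
Lemma discrepancy_future n :
  [/\ future_indep P H p (n.+1 * L) (S n), future_indep P H p (n.+1 * L) (Z n)
    & future_indep P H p (n.+1 * L) (fun t => S n t * Z n t)].
Proof.
elim: n => [|n [IS IZ ISZ]].
  have -> : S 0 = fun=> 0 by apply/funext => t; rewrite /S /discrepancy big_ord0.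
  split; try exact: (future_indep_cst mH indep).
  have -> : (fun t => 0 * Z 0 t) = fun=> 0 by apply/funext => t; rewrite mul0r.
  exact: (future_indep_cst mH indep).
have leL : (n.+1 * L <= n.+2 * L)%N by rewrite leq_mul2r leqnSn orbT.
have [IZX _] := future_indep_period mH sL IZ.
have [ISZX _] := future_indep_period mH sL ISZ.
have := future_indep_le leL IZ => IZ'.
have := future_indep_le leL IS => IS'.
have f1 : future_indep P H p (n.+2 * L) (fun=> 1) by exact: (future_indep_cst mH indep).
split.
- rewrite (_ : S n.+1 = fun t => S n t + (Z n t * (X n t)%:R - q * Z n t)).
    apply: (future_indepD mH) => //; apply: (future_indepB mH) => //; exact: (future_indepZ mH).
  by apply/funext => t; rewrite discrepancyS; ring.
(* The Boolean recurrence of the chain becomes a polynomial, to which the closure properties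
   apply. *)
- rewrite (_ : Z n.+1 = fun t => 1 - c%:R * (Z n t * (X n t)%:R)).
    apply: (future_indepB mH) => //; exact: (future_indepZ mH).
  apply/funext => t; rewrite /Z/=.
  by case: c; case: (chain _ _ _ _); case: (X n t); rewrite /=; ring.
(* Since Z and X take the values 0 and 1, their squares drop out and the product stays in the span
   of terms already controlled. *)
- rewrite (_ : (fun _ => _) = fun t => (S n t - c%:R * (S n t * Z n t * (X n t)%:R)) +
     ((1 - c%:R + q * c%:R) * (Z n t * (X n t)%:R) - q * Z n t)).
    apply: (future_indepD mH); apply: (future_indepB mH) => //; exact: (future_indepZ mH).
  apply/funext => t; rewrite discrepancyS /Z/=.
  by case: c; case: (chain _ _ _ _); case: (X n t); rewrite /=; ring.
Qed.

(** Increments are orthogonal to the past and bounded by 1, so each step adds at most 1. *)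
Lemma discrepancy_second_moment n : (\int[P]_t ((S n t) ^+ 2)%:E <= n%:R%:E)%E.
Proof.
have bm k : bounded_measurable (S k) by have [[]] := discrepancy_future k.
have bS2 k : bounded_measurable (fun t => S k t ^+ 2).
  by under eq_fun do rewrite expr2; exact: bounded_measurableM.
rewrite -[leLHS]fineK ?lee_fin; last first.
  apply: (integrable_fin_num measurableT).
  exact: (bounded_measurable_integrable P (bS2 n)).
rewrite -/(Rintegral P setT _).
elim: n => [|n IH].
  have -> : (fun t => S 0 t ^+ 2) = fun=> 0.
    by apply/funext => t; rewrite /S /discrepancy big_ord0 expr0n.
  by rewrite Rintegral_cst// mul0r.
have [_ _ fSZ] := discrepancy_future n.
have [fSZX eSZX] := future_indep_period mH sL fSZ.
have bSZ := fSZ.1; have bSZX := fSZX.1.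
rewrite (_ : (fun t => S n.+1 t ^+ 2) = fun t => (S n t ^+ 2 +
   2 * (S n t * Z n t * (X n t)%:R - q * (S n t * Z n t))) +
   (S n.+1 t - S n t) ^+ 2); last first.
  by apply/funext => t; rewrite discrepancyS; ring.
have bcst := @bounded_measurable_cst _ T R.
have bqSZ := bounded_measurableM (bcst q) bSZ.
have bd : bounded_measurable (fun t => S n t * Z n t * (X n t)%:R - q * (S n t * Z n t)).
  have := bounded_measurableD bSZX (bounded_measurableM (bcst (-1)) bqSZ).
  by under eq_fun do rewrite mulN1r.
have b2d := bounded_measurableM (bcst 2) bd.
have binc : bounded_measurable (fun t => (S n.+1 t - S n t) ^+ 2).
  have := bounded_measurableD (bm n.+1) (bounded_measurableM (bcst (-1)) (bm n)).
  move=> h; have := bounded_measurableM h h.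
  by under eq_fun do rewrite mulN1r -expr2.
have bI := @bounded_measurable_integrable _ _ _ P.
rewrite RintegralD//; [|exact: bI (bounded_measurableD (bS2 n) b2d)|exact: bI].
rewrite RintegralD//; [|exact: bI|exact: bI].
rewrite RintegralZl//; [|exact: bI].
rewrite RintegralB//; [|exact: bI|exact: bI].
rewrite RintegralZl//; [|exact: bI].
(* The cross term vanishes because X has conditional mean [q] given S Z. *)
rewrite eSZX subrr mulr0 addr0 -natr1 lerD//.
apply: (@le_trans _ _ (\int[P]_t 1)); last first.
  by rewrite Rintegral_probability_cst.
apply: le_Rintegral => //; [exact: bI|exact: bI|move=> t _].
have := discrepancy_step n t; set x := _ - _.
by rewrite ler_norml => /andP[]; nra.
Qed.

Lemma discrepancy_ae :
  {ae P, forall t, (fun n => S n t / n%:R) @ \oo --> (0 : R)}.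
Proof.
apply: ae_cvg0_of_second_moments.
- by move=> n; have [[[]]] := discrepancy_future n.
- exact: discrepancy_step.
- exact: discrepancy_second_moment.
Qed.

End discrepancy.

(** * Deterministic dynamics of the capital for a fixed sequence [h] of fair tosses *)

Section pattern_dynamics.
Variables (r s : nat) (h : nat -> bool) (cap : nat -> int).
Hypotheses (r3 : (3 <= r)%N) (sr : (2 * s < r)%N).
Let L := (2 * s + (r - 2))%N.
Hypothesis capS : forall n, cap n.+1 = cap n +
  (if (if game_at (pattern s r) n is A then h n else ~~ (r%:Z %| cap n)%Z)
   then 1 else -1).

Lemma size_pattern : size (pattern s r) = L.
Proof.
rewrite /pattern size_cat size_nseq /L; congr addn.
by elim: s => //= n ->; lia.
Qed.

Lemma game_at_period k j : (j < L)%N ->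
  game_at (pattern s r) (k * L + j) = nth B (pattern s r) j.
Proof. by move=> jL; rewrite /game_at size_pattern modnMDl modn_small. Qed.

Lemma nth_AB i : (i < s)%N ->
  nth B (pattern s r) (2 * i) = A /\ nth B (pattern s r) (2 * i).+1 = B.
Proof.
rewrite /pattern; elim: s i => // n IH [|i] // ltin.
rewrite mulnS !addSn add0n /=. exact: IH.
Qed.

Lemma nth_tailB j : (2 * s <= j)%N -> nth B (pattern s r) j = B.
Proof.
move=> sj; rewrite /pattern nth_cat.
have -> : size (flatten (nseq s [:: A; B])) = (2 * s)%N.
  by elim: s => //= n ->; lia.
by rewrite ltnNge sj /= nth_nseq; case: ifP.
Qed.

Lemma multiple_add_ndvd (m d : int) : 0 < d < r%:Z -> (r%:Z %| r%:Z * m + d)%Z = false.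
Proof.
move=> /andP[d0 dr]; apply/negP => /dvdzP[q mq].
have dq : d = (q - m) * r%:Z by lia.
have [q0|q1] : q - m <= 0 \/ 1 <= q - m by lia.
  by have := mulr_le0_ge0 q0 (le0z_nat r); lia.
by have := ler_wpM2r (le0z_nat r) q1; lia.
Qed.

Lemma capA n : game_at (pattern s r) n = A -> cap n.+1 = cap n + (if h n then 1 else -1).
Proof. by move=> gA; rewrite capS gA. Qed.

Lemma capB_multiple n m : game_at (pattern s r) n = B ->
  cap n = r%:Z * m -> cap n.+1 = cap n - 1.
Proof. by move=> gB cn; rewrite capS gB {2}cn dvdz_mulr. Qed.

Lemma capB_between n m d : game_at (pattern s r) n = B ->
  cap n = r%:Z * m + d -> 0 < d < r%:Z -> cap n.+1 = cap n + 1.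
Proof. by move=> gB cn hd; rewrite capS gB {2}cn multiple_add_ndvd. Qed.

(** Game B climbs to the next multiple of [r], then alternates between it and the value one
    below. *)
Lemma cap_Bs n k (M : int) (d : nat) :
  (forall j, (j < k)%N -> game_at (pattern s r) (n + j) = B) ->
  (d < r)%N -> cap n = r%:Z * M - d%:Z ->
  cap (n + k)%N = if (k <= d)%N then r%:Z * M - d%:Z + k%:Z
                  else r%:Z * M - (odd (k - d) : nat)%:Z.
Proof.
move=> gB dr cn; elim: k gB => [|k IH] gB; first by rewrite addn0 cn addr0.
rewrite addnS; have := IH (fun j jk => gB j (ltnW jk)) => {}IH.
have {}gB := gB k (ltnSn k).
have [kd|dk] := ltnP k d.
  move: IH; rewrite (ltnW kd) => IH.
  rewrite (@capB_between _ (M - 1) (r%:Z - d%:Z + k%:Z))// ?IH//; lia.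
have [kd|kd] := eqVneq k d.
  move: IH gB; rewrite kd leqnn => IH gB.
  by rewrite (@capB_multiple _ M)// ?IH ?subSnn; lia.
move: IH; rewrite leqNgt ltn_neqAle eq_sym kd dk /= subSn// oddS => IH.
case: (odd (k - d)) IH => /= IH.
  by rewrite (@capB_between _ (M - 1) (r%:Z - 1))// ?IH//; lia.
by rewrite (@capB_multiple _ M)// ?IH; lia.
Qed.

(** The witness [a] counts the heads so far. After a head, B adds one more unit since 2a + 1 < r;
    after a tail, B undoes the loss, even from one below the multiple. *)
Lemma cap_AB_multiple k m i : cap (k * L) = r%:Z * m -> (i <= s)%N ->
  exists a : nat, [/\ (a <= i)%N, cap (k * L + 2 * i) = r%:Z * m + (2 * a)%:Z
    & all_tails h (k * L) i = (a == 0)%N].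
Proof.
move=> ck; elim: i => [|i IH] lis.
  by exists 0%N; rewrite all_tails0 muln0 !addn0 ck addr0.
have [a [ai ca ta]] := IH (ltnW lis).
have [n1 n2] := nth_AB lis.
have iL : ((2 * i).+1 < L)%N by rewrite /L; lia.
have gA : game_at (pattern s r) (k * L + 2 * i) = A by rewrite game_at_period//; lia.
have gB : game_at (pattern s r) (k * L + 2 * i).+1 = B by rewrite -addnS game_at_period.
have cA := capA gA.
rewrite all_tailsS ta (_ : k * L + 2 * i.+1 = (k * L + 2 * i).+2)%N; last by lia.
case: (h (k * L + 2 * i)) cA => /= cA.
  exists a.+1; split=> //; last by rewrite andbF.
  by rewrite (@capB_between _ m (2 * a).+1%:Z)// ?cA ?ca; lia.
exists a; split; rewrite ?andbT//; first lia.
case: a ai ca ta cA => [|a] ai ca _ cA.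
  by rewrite (@capB_between _ (m - 1) (r%:Z - 1))// ?cA ?ca; lia.
by rewrite (@capB_between _ m (2 * a).+1%:Z)// ?cA ?ca; lia.
Qed.

(** A head leads to the multiple, where B loses; a tail leads to two below it, where B wins. Either
    way AB has no net effect. *)
Lemma cap_AB_pred k m i : cap (k * L) = r%:Z * m - 1 -> (i <= s)%N ->
  cap (k * L + 2 * i) = r%:Z * m - 1.
Proof.
move=> ck; elim: i => [|i IH] lis; first by rewrite muln0 addn0.
have {IH}ca := IH (ltnW lis).
have [n1 n2] := nth_AB lis.
have iL : ((2 * i).+1 < L)%N by rewrite /L; lia.
have gA : game_at (pattern s r) (k * L + 2 * i) = A by rewrite game_at_period//; lia.
have gB : game_at (pattern s r) (k * L + 2 * i).+1 = B by rewrite -addnS game_at_period.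
have cA := capA gA.
rewrite (_ : k * L + 2 * i.+1 = (k * L + 2 * i).+2)%N; last by lia.
case: (h (k * L + 2 * i)) cA => /= cA.
  by rewrite (@capB_multiple _ m)// ?cA ?ca; lia.
by rewrite (@capB_between _ (m - 1) (r%:Z - 2))// ?cA ?ca; lia.
Qed.

Lemma cap_final_Bs k (M : int) (d : nat) : (d < r)%N ->
  cap (k * L + 2 * s) = r%:Z * M - d%:Z ->
  cap (k.+1 * L) = if (r - 2 <= d)%N then r%:Z * M - d%:Z + (r - 2)%:Z
                   else r%:Z * M - (odd (r - 2 - d) : nat)%:Z.
Proof.
move=> dr ck; have -> : (k.+1 * L = k * L + 2 * s + (r - 2))%N by rewrite /L; lia.
apply: cap_Bs => // j jr; rewrite -addnA game_at_period; last by rewrite /L; lia.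
by apply: nth_tailB; lia.
Qed.

(** The flag [z] says that the period starts at a multiple of [r]. The final plays of B first reach
    a multiple, and the parity of the number of remaining plays decides where they end. *)
Lemma cap_period k m (z : bool) : z || odd r ->
  cap (k * L) = r%:Z * m - (~~ z : nat)%:Z ->
  let x := all_tails h (k * L) s in
  cap (k.+1 * L) = r%:Z * (m + (z && ~~ x : nat)%:Z) - ([&& odd r, z & x] : nat)%:Z.
Proof.
move=> + + x; case: z => /= zr ck.
  have [|a [sa ca ta]] := @cap_AB_multiple k m s _ (leqnn s); first by rewrite ck subr0.
  rewrite /x ta; case: a sa ca {ta} => [|a] sa ca /=.
    have := @cap_final_Bs k m 0; rewrite ca => ->; [|lia|lia].
    case: ifP => [|_]; first lia.
    by rewrite subn0 oddB ?addbF ?andbT ?addr0//; lia.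
  (* With [a.+1] heads, the next multiple is r - 2 (a + 1) wins away, which leaves an even number 2a
     of plays. *)
  have := @cap_final_Bs k (m + 1) (r - 2 * a.+1); rewrite ca => ->; [|lia|lia].
  rewrite andbF; case: ifP => [|_]; first lia.
  have -> : (r - 2 - (r - 2 * a.+1) = a.*2)%N by lia.
  by rewrite odd_double.
have /= ca := cap_AB_pred ck (leqnn s).
have := @cap_final_Bs k m 1; rewrite ca => ->; [|lia|lia].
rewrite andbF; case: ifP => [|_]; first lia.
have -> : (r - 2 - 1 = r - 3)%N by lia.
by rewrite oddB// zr; lia.
Qed.

(** The distance up to the next multiple is at most r - 1, so r - 2 plays of B miss it by at most
    one. *)
Lemma cap_first_period : exists m (b : bool), cap L = r%:Z * m - (~~ b : nat)%:Z.
Proof.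
have [M [d [dr cd]]] : exists M (d : nat), (d < r)%N /\ cap (2 * s) = r%:Z * M - d%:Z.
  (* Negating before and after the division rounds up instead of down. *)
  exists (- ((- cap (2 * s)) %/ r%:Z)%Z), `|((- cap (2 * s)) %% r%:Z)%Z|%N.
  have r0 : r%:Z != 0 by lia.
  have := divz_eq (- cap (2 * s)) r%:Z; have := modz_ge0 (- cap (2 * s)) r0.
  have := ltz_pmod (- cap (2 * s)) (d := r%:Z); nia.
have := @cap_final_Bs 0 M d dr; rewrite mul1n mul0n add0n cd => ->//.
case: ifP => hd; last by exists M, (~~ odd (r - 2 - d)); rewrite negbK.
by exists M, (d == r - 2)%N; lia.
Qed.

Lemma cap_parity n : (2 %| cap n - cap 0 - n%:Z)%Z.
Proof.
clear r3 sr.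
elim: n => [|n]; first by rewrite subrr subr0.
move=> /dvdzP[q Hq]; apply/dvdzP; rewrite capS; case: ifP => _.
  by exists q; lia.
by exists (q - 1); lia.
Qed.

Lemma cap_dist m k : `|cap (m + k)%N - cap m| <= k%:Z.
Proof.
clear r3 sr.
by elim: k => [|k]; [rewrite addn0 subrr|rewrite addnS capS; case: ifP => _; lia].
Qed.

Hypothesis even_start : ~~ odd r -> (2 %| cap 0)%Z.

Let xi k := all_tails h (k.+1 * L) s.

(* The capital at the start of period k+1; period 0 only serves to bring the
   capital next to a multiple of r. *)
Lemma cap_periods : exists m0 (b : bool), forall k,
  cap (k.+1 * L) =
    r%:Z * (m0 + \sum_(j < k) (chain (odd r) b xi j && ~~ xi j : nat)%:Z)
    - (~~ chain (odd r) b xi k : nat)%:Z.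
Proof.
have [m0 [b cL]] := cap_first_period.
have br : b || odd r.
  have [_|re] := boolP (odd r); rewrite ?orbT// orbF.
  (* For even [r], the period length and the initial capital are even, hence so is the capital after
     period 0; one below a multiple would be odd. *)
  have /dvdzP[q0 h0] := even_start re; have /dvdzP[q1 h1] := cap_parity L.
  have hr : r = (r./2).*2 by rewrite even_halfK.
  have rm : r%:Z * m0 = 2 * (r./2%:Z * m0) by rewrite {1}hr; lia.
  by move: cL h1; rewrite rm /L; case: b => //=; lia.
exists m0, b => k.
suff [] : cap (k.+1 * L) =
    r%:Z * (m0 + \sum_(j < k) (chain (odd r) b xi j && ~~ xi j : nat)%:Z)
    - (~~ chain (odd r) b xi k : nat)%:Z /\ chain (odd r) b xi k || odd r by [].
elim: k => [|k [IH1 IH2]]; first by rewrite mul1n big_ord0 addr0.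
split; last by rewrite /=; case: (odd r); rewrite ?orbT.
by rewrite (cap_period IH2 IH1) big_ord_recr /= -/(xi k) addrA negbK.
Qed.

End pattern_dynamics.

(** * Passage from the chain to the limiting rate along one path *)

Section limit_rate.
Variable R : realType.

(** Summing z' = 1 - c z x over time expresses the number of visits to the first state through the
    discrepancy, up to boundary terms; successful periods are those visits minus the sum of z x. *)
Lemma chain_sum (c b : bool) (xi : nat -> bool) (q : R) k :
  (1 + c%:R * q) * (\sum_(j < k) (chain c b xi j && ~~ xi j : nat)%:Z)%:~R =
  (1 - q) * (k%:R - (chain c b xi k)%:R + b%:R)
  - (1 + c%:R) * discrepancy c b xi q k.
Proof.
elim: k => [|k IH].
  by rewrite /discrepancy !big_ord0 /= mulr0z; ring.
rewrite /discrepancy !big_ord_recr -/(discrepancy c b xi q k) rmorphD /= mulrDr IH.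
rewrite -(natr1 k).
by case: c {IH}; case: (chain _ _ _ _); case: (xi k); rewrite /=; ring.
Qed.

Lemma cvg_rate (v : nat -> int) (S : nat -> R) (L : nat) (mu M K : R) :
  (0 < L)%N -> 0 <= K -> (fun n => S n / n%:R) @ \oo --> (0 : R) ->
  (forall n, (L <= n)%N ->
     `|(v n)%:~R - mu * n%:R| <= M + K * `|S (n %/ L).-1|) ->
  (fun n => (v n)%:~R / n%:R) @ \oo --> mu.
Proof.
move=> L0 K0 cS bnd; apply/cvgrPdist_le => e e0.
(* [K + 1] replaces [K], which may be 0. *)
have e1 : 0 < e / (2 * (K + 1)) by apply: divr_gt0 => //; lra.
move/cvgrPdist_le: cS => /(_ _ e1)[N0 _ HN].
have [N1 HN1] : exists N : nat, 2 * M / e <= N%:R.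
  by exists (Num.trunc (2 * M / e)).+1; rewrite ltW// truncnS_gt.
exists (L * (N0 + 2) + N1)%N => // n /= hn.
have Ln : (L <= n)%N by nia.
have n0 : 0 < n%:R :> R by rewrite ltr0n; lia.
have nN0 : (N0 + 2 <= n %/ L)%N by rewrite leq_divRL// mulnC; lia.
have nn : (n %/ L <= n)%N by exact: leq_div.
have := HN (n %/ L).-1; rewrite /= => /(_ ltac:(lia)).
rewrite sub0r normrN normrM normfV normr_nat ler_pdivrMr; last by rewrite ltr0n; lia.
have := bnd n Ln; set a := `|S _|; set j := _.-1 => h1 h2.
have jn : j%:R <= n%:R :> R by rewrite ler_nat /j; lia.
have a0 : 0 <= a by exact: normr_ge0.
have -> : mu - (v n)%:~R / n%:R = - (((v n)%:~R - mu * n%:R) / n%:R).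
  by field; rewrite gt_eqF.
rewrite normrN normrM normfV normr_nat ler_pdivrMr//; apply: (le_trans h1).
have hM : M <= e / 2 * n%:R.
  have : 2 * M / e <= n%:R by rewrite (le_trans HN1)// ler_nat (leq_trans (leq_addl _ _) hn).
  rewrite ler_pdivrMr//; lra.
have hK : K * a <= e / 2 * n%:R.
  apply: (@le_trans _ _ ((K + 1) * a)); first by rewrite ler_wpM2r//; lra.
  apply: (@le_trans _ _ ((K + 1) * (e / (2 * (K + 1)) * n%:R))).
    by rewrite ler_wpM2l ?(le_trans h2)// ?ler_wpM2l//; lra.
  rewrite (_ : (K + 1) * _ = e / 2 * n%:R)//; field.
  by rewrite gt_eqF//; lra.
lra.
Qed.

(* For r odd, the stationary law of the two-state chain gives the multiples of
   r weight 1 / (1 + q), and from there a period ends one multiple of r higher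
   with probability 1 - q. *)
Definition rate (r s : nat) : R :=
  let q := (1 / 2) ^+ s in
  r%:R * (1 - q) / ((1 + (odd r)%:R * q) * (2 * s + (r - 2))%:R).

(** The hypothesis on discrepancies covers both values of [b], because the initial state depends on
    the path. *)
Lemma capital_rate (r s : nat) (h : nat -> bool) (cap : nat -> int)
    (L := (2 * s + (r - 2))%N) (xi := fun k => all_tails h (k.+1 * L) s) :
  (3 <= r)%N -> (2 * s < r)%N ->
  (forall n, cap n.+1 = cap n +
    (if (if game_at (pattern s r) n is A then h n else ~~ (r%:Z %| cap n)%Z)
     then 1 else -1)) ->
  (~~ odd r -> (2 %| cap 0%N)%Z) ->
  (forall b, (fun n => discrepancy (odd r) b xi ((1 / 2) ^+ s) n / n%:R : R)
     @ \oo --> (0 : R)) ->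
  (fun n => (cap n - cap 0%N)%:~R / n%:R : R) @ \oo --> rate r s.
Proof.
move=> r3 sr capS ev cS.
have L0 : (0 < L)%N by rewrite /L; lia.
have [m0 [b capE]] := cap_periods r3 sr capS ev.
set q : R := (1 / 2) ^+ s.
have q01 : 0 <= q <= 1 by rewrite exprn_ge0 ?exprn_ile1//; lra.
set c : R := (odd r)%:R; have c01 : 0 <= c <= 1 by rewrite ler0n lern1 leq_b1.
set mu := rate r s.
have LR0 : 0 < L%:R :> R by rewrite ltr0n.
have D0 : 0 < 1 + c * q by nra.
have muE : mu * L%:R * (1 + c * q) = r%:R * (1 - q).
  rewrite /mu /rate -/q -/c -/L; field.
  by rewrite !gt_eqF.
have mu0 : 0 <= mu.
  rewrite /mu /rate -/q -/c -/L divr_ge0//; rewrite mulr_ge0 ?ler0n// ?(ltW D0)//; lra.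
pose S := discrepancy (odd r) b xi q.
apply: (@cvg_rate _ S L mu (L%:R + 1 + r%:R + `|r%:R * m0%:~R - (cap 0%N)%:~R| + 2 * (mu * L%:R))
  (2 * r%:R)) => //; first exact: (cS b).
move=> n Ln; set k := (n %/ L).-1.
have nE : n = (k.+1 * L + n %% L)%N.
  by rewrite /k prednK ?divn_gt0// -divn_eq.
have jL : (n %% L < L)%N by rewrite ltn_mod.
have hc : `|(cap n)%:~R - (cap (k.+1 * L))%:~R| <= L%:R :> R.
  have := cap_dist capS (k.+1 * L) (n %% L); rewrite -nE -intrB -intr_norm.
  by move=> h1; rewrite -[L%:R]/(L%:Z%:~R) ler_int (le_trans h1)// lez_nat ltnW.
set sm : int := \sum_(j < k) (chain (odd r) b xi j && ~~ xi j : nat)%:Z.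
set zk := chain (odd r) b xi k.
have capR : (cap (k.+1 * L))%:~R = r%:R * m0%:~R + r%:R * sm%:~R - (~~ zk)%:R :> R.
  by rewrite capE -/sm -/zk rmorphB /= intrM rmorphD /= mulrDr.
have smE : (1 + c * q) * sm%:~R =
  (1 - q) * (k%:R - zk%:R + b%:R) - (1 + c) * S k by exact: chain_sum.
have hS : `|r%:R * sm%:~R - mu * L%:R * k%:R| <= r%:R + 2 * r%:R * `|S k|.
  have e1 : (r%:R * sm%:~R - mu * L%:R * k%:R) * (1 + c * q) =
     r%:R * ((1 - q) * (b%:R - zk%:R)) - r%:R * ((1 + c) * S k).
    transitivity (r%:R * ((1 + c * q) * sm%:~R) - k%:R * (mu * L%:R * (1 + c * q))).
      by ring.
    by rewrite muE smE; ring.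
  apply: (@le_trans _ _ (`|r%:R * sm%:~R - mu * L%:R * k%:R| * (1 + c * q))).
    by rewrite ler_peMr//; nra.
  rewrite -(ger0_norm (ltW D0)) -normrM e1.
  apply: (le_trans (ler_normB _ _)); rewrite !normrM (ger0_norm (ler0n _ r)).
  have h1 : `|1 - q| <= 1 by rewrite ler_norml; lra.
  have h2 (b1 b2 : bool) : `|b1%:R - b2%:R| <= 1 :> R.
    by rewrite ler_norml; case: b1; case: b2; rewrite /=; lra.
  have h3 : `|1 + c| <= 2 by rewrite ler_norml; lra.
  apply: lerD; first by rewrite -[leRHS]mulr1 ler_wpM2l// mulr_ile1.
  by rewrite (mulrC 2) -mulrA ler_wpM2l// ler_wpM2r.
have nR : n%:R = k%:R * L%:R + L%:R + (n %% L)%:R :> R.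
  by rewrite {1}nE natrD natrM -natr1; ring.
have jL0 : 0 <= (n %% L)%:R :> R by [].
have jL1 : (n %% L)%:R <= L%:R :> R by rewrite ler_nat ltnW.
set j : R := (n %% L)%:R in nR jL0 jL1.
rewrite rmorphB /= nR.
(* The error splits into the current partial period, the chain state, the fluctuation over full
   periods, the start, and the drift over period 0 and the partial period. *)
have -> : (cap n)%:~R - (cap 0%N)%:~R - mu * (k%:R * L%:R + L%:R + j) =
  ((cap n)%:~R - (cap (k.+1 * L))%:~R) + (- (~~ zk)%:R)
  + (r%:R * sm%:~R - mu * L%:R * k%:R) + (r%:R * m0%:~R - (cap 0%N)%:~R)
  + (- (mu * (L%:R + j))) by rewrite capR; ring.
have hz : `|- (~~ zk)%:R| <= 1 :> R by rewrite normrN normr_nat lern1 leq_b1.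
have hj : `|- (mu * (L%:R + j))| <= 2 * (mu * L%:R).
  rewrite normrN ger0_norm; last by rewrite mulr_ge0//; lra.
  by rewrite mulrCA ler_wpM2l//; lra.
have normD5 (x1 x2 x3 x4 x5 : R) :
    `|x1 + x2 + x3 + x4 + x5| <= `|x1| + `|x2| + `|x3| + `|x4| + `|x5|.
  by do 4! (rewrite (le_trans (ler_normD _ _))// ?lerD2r).
by apply: (le_trans (normD5 _ _ _ _ _)); move: hc hS hz hj; lra.
Qed.

End limit_rate.

(** * Asymptotics of the explicit rate *)

Section asymptotics.
Variable R : realType.

Lemma sqr_le_expn2 n : (n ^ 2 <= 2 ^ n.+1)%N.
Proof.
elim: n => // n IH; rewrite (expnS 2 n.+1).
(* The inequality (n + 1)^2 <= 2 n^2 holds only from n = 3 on. *)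
case: n IH => [//|[//|[//|n]]] IH; apply: leq_trans (leq_mul (leqnn 2) IH); nia.
Qed.

Lemma rate_estimate (r s : nat) : (1 <= s)%N -> (2 ^ s.+1 <= r < 2 ^ s.+2)%N ->
  `|(1 - rate R r s) / ((2 * s)%:R / r%:R) - 1| <= 11 / s%:R.
Proof.
move=> s1 /andP[rl ru].
have rs : s%:R ^+ 2 <= r%:R :> R.
  by rewrite -natrX ler_nat (leq_trans (sqr_le_expn2 s)).
have r3 : (3 <= r)%N by apply: leq_trans rl; rewrite (leq_trans _ (leq_pexp2l _ (n1 := 2) _)).
set q : R := (1 / 2) ^+ s; set c : R := (odd r)%:R.
have c01 : 0 <= c <= 1 by rewrite ler0n lern1 leq_b1.
have q01 : 0 <= q <= 1 by rewrite exprn_ge0 ?exprn_ile1//; lra.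
have q2 : q * 2 ^+ s = 1 by rewrite /q -exprMn mul1r mulVf ?expr1n.
have xl : 2 <= r%:R * q.
  have h : 2 * 2 ^+ s <= r%:R :> R by rewrite -exprS -natrX ler_nat.
  have -> : 2 = (2 * 2 ^+ s) * q by rewrite -mulrA (mulrC _ q) q2 mulr1.
  by apply: ler_wpM2r => //; case/andP: q01.
have xu : r%:R * q <= 4.
  have h : r%:R <= 4 * 2 ^+ s :> R.
    by have -> : 4 = 2 ^+ 2 :> R by [ring]; rewrite -exprD add2n -natrX ler_nat ltnW.
  have -> : 4 = (4 * 2 ^+ s) * q by rewrite -mulrA (mulrC _ q) q2 mulr1.
  by apply: ler_wpM2r => //; case/andP: q01.
have LE : (2 * s + (r - 2))%:R = 2 * s%:R + r%:R - 2 :> R.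
  by rewrite natrD natrM natrB ?addrA// ltnW.
rewrite /rate -/q -/c LE natrM.
have sR : 1 <= s%:R :> R by rewrite ler1n.
have rR : 3 <= r%:R :> R by rewrite ler_nat.
move: s%:R r%:R sR rR rs xl xu => S r' sR rR rs xl xu {LE}.
have cq0 : 0 <= c * q by nra.
have cq1 : c * q <= 1 by nra.
have D0 : 0 < S * ((1 + c * q) * (2 * S + r' - 2)) by rewrite !mulr_gt0//; lra.
have -> : (1 - r' * (1 - q) / ((1 + c * q) * (2 * S + r' - 2))) / (2 * S / r') - 1 =
  (2 * S * (2 - 2 * S) + r' * (r' * q + c * (r' * q) - 2) - 2 * (c * (r' * q))
   - 2 * S * (c * q * (2 * S - 2))) / (2 * (S * ((1 + c * q) * (2 * S + r' - 2)))).
  by field; rewrite !gt_eqF//; lra.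
move: (r' * q) xl xu => x xl xu.
have cx0 : 0 <= c * x by nra.
have cx4 : c * x <= 4 by nra.
move: (c * q) cq0 cq1 D0 => u u0 u1 D0.
(* Every term is O(r) because S^2 <= r and 2 <= x <= 4; the constant 22 is generous. The denominator
   is at least 2 S r, whence 11 / S. *)
have N22 : `|2 * S * (2 - 2 * S) + r' * (x + c * x - 2) - 2 * (c * x)
   - 2 * S * (u * (2 * S - 2))| <= 22 * r'.
  have h1 : 0 <= r' * (x + c * x - 2) <= 6 * r' by apply/andP; split; nra.
  have w0 : 0 <= u * (2 * S - 2) by rewrite mulr_ge0//; lra.
  have w1 : u * (2 * S - 2) <= 2 * S - 2 by rewrite ler_piMl//; lra.
  move: (r' * _) (u * _) h1 w0 w1 => A w /andP[A0 A1] w0 w1.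
  have Sw0 : 0 <= S * w by rewrite mulr_ge0//; lra.
  have Sw1 : S * w <= S * (2 * S - 2) by rewrite ler_wpM2l//; lra.
  have SS : 0 <= S * (S - 1) by rewrite mulr_ge0//; lra.
  by rewrite ler_norml; apply/andP; split; lra.
rewrite normrM normfV (gtr0_norm (_ : 0 < 2 * _)); last by rewrite mulr_gt0.
rewrite ler_pdivrMr; last by rewrite mulr_gt0.
apply: (le_trans N22).
have -> : 11 / S * (2 * (S * ((1 + u) * (2 * S + r' - 2)))) =
   22 * ((1 + u) * (2 * S + r' - 2)) by field; rewrite gt_eqF//; lra.
nra.
Qed.

Lemma rate_asymptotics :
  (fun r : nat => (1 - rate R r (s_ r)) / ((2 * s_ r)%:R / r%:R)) @ \oo --> (1 : R).
Proof.
apply/cvgrPdist_le => e e0.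
have [N HN] : exists N : nat, 11 / e <= N%:R.
  by exists (Num.trunc (11 / e)).+1; rewrite ltW// truncnS_gt.
exists (2 ^ N.+2)%N => // r /= hr.
have r0 : (0 < r)%N by apply: leq_trans hr; rewrite expn_gt0.
have lr : (N.+2 <= trunc_log 2 r)%N by apply: trunc_log_max.
(* The truncated subtraction in [s_] is exact here, as the logarithm is positive. *)
have sE : (s_ r).+1 = trunc_log 2 r by rewrite /s_; lia.
have s1 : (1 <= s_ r)%N by lia.
rewrite distrC (le_trans (rate_estimate s1 _))//.
  by rewrite sE trunc_logP// trunc_log_ltn.
rewrite ler_pdivrMr ?ltr0n// mulrC -ler_pdivrMr// (le_trans HN)// ler_nat; lia.
Qed.

End asymptotics.

(** * From the coin tosses to the almost sure rate *)

Section rate_of_profit.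
Context d (T : measurableType d) (R : realType) (P : probability T R).
Variables (r : nat) (heads : coin -> nat -> set T).
Hypothesis r3 : (3 <= r)%N.
Hypothesis tosses : independent_tosses P r (0 : R) heads.

Let measurable_heads c n : measurable (heads c n).
Proof. by have [[mh _] _] := tosses; exact: (mh (c, n)). Qed.

(** This turns independence of events into the integral form used above: a product of indicators is
    the indicator of an intersection. *)
Lemma fair_independent (l : seq nat) : uniq l ->
  \int[P]_t (\prod_(i <- l) \1_(heads fair i) t) = (1 / 2) ^+ size l :> R.
Proof.
move=> ul.
have -> : (fun t => \prod_(i <- l) \1_(heads fair i) t) =
   \1_(\bigcap_(j : 'I_(size l)) heads fair (nth 0%N l j)) :> (T -> R).
  apply/funext => t; rewrite (big_nth 0%N) big_mkord indicE.
  have [tI|tI] := boolP (t \in _).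
    rewrite big1// => i _; rewrite indicE mem_set//.
    by move/set_mem: tI => /(_ i I).
  have [i ti] : exists i : 'I_(size l), t \notin heads fair (nth 0%N l i).
    apply: contrapT => /forallNP h; move/negP: tI; apply.
    by apply/mem_set => i _; have /negP/negPn/set_mem := h i.
  by rewrite (bigD1 i)//= indicE (negbTE ti) mul0r.
have [[_ ind] pr] := tosses.
rewrite /Rintegral integral_indic//; last first.
  by apply: fin_bigcap_measurable => // i _; exact: measurable_heads.
rewrite setIT.
have inj : injective (fun j : 'I_(size l) => (fair, nth 0%N l j)).
  by move=> i j [] /eqP; rewrite nth_uniq// => /eqP/val_inj.
have /= -> := ind _ _ inj.
under eq_bigr do rewrite pr.
by rewrite prodEFin /= prodr_const card_ord.
Qed.

(** For rho = 0 the coins have probabilities 0 and 1 of heads, as r - 1 > 0, and countably many null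
    events may be discarded together. *)
Lemma ae_deterministic_coins :
  {ae P, forall t n, t \notin heads coin0 n /\ t \in heads coin1 n}.
Proof.
have [_ pr] := tosses.
apply: ae_foralln => n; apply: filterI.
  exists (heads coin0 n); split; first exact: measurable_heads.
    transitivity (coin_prob r (0 : R) coin0)%:E; first exact: pr.
    by rewrite /coin_prob expr0n (_ : _ == _ = false) ?mul0r//; lia.
  by move=> t /= /negP; rewrite negbK; exact: set_mem.
exists (~` heads coin1 n); split; first exact: measurableC.
  have p1 : P (heads coin1 n) = 1%E by rewrite pr /coin_prob addr0 divr1.
  have := probability_setC P (measurable_heads coin1 n).
  by rewrite p1 subee.
by move=> t /=; apply: contra_not => /mem_set.
Qed.

Lemma rate_of_profitE (s : nat) (x0 : int) : (2 * s < r)%N ->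
  (~~ odd r -> (2 %| x0)%Z) ->
  rate_of_profit P r heads (pattern s r) x0 = rate R r s.
Proof.
move=> sr ev.
have cvg_ae : {ae P, forall t : T,
    (fun n : nat => (profit r heads (pattern s r) x0 n t)%:~R / n%:R : R)
      @ \oo --> rate R r s}.
  pose L := (2 * s + (r - 2))%N.
  have sL : (2 * s <= L)%N by rewrite leq_addr.
  have half01 : 0 <= (1 / 2 : R) <= 1 by lra.
  have disc b := discrepancy_ae (measurable_heads fair) fair_independent sL half01 (odd r) b.
  apply: filterS (filterI ae_deterministic_coins (filterI (disc false) (disc true))).
  move=> t [det [df dt]].
  apply: (@capital_rate _ r s (fun n => t \in heads fair n)
    (fun n => capital r heads (pattern s r) x0 n t)) => //.
  - move=> n /=; have [h0 h1] := det n; rewrite /coin_of.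
    case: (game_at _ _) => /=; first by case: ifP.
    by case: (_ %| _)%Z => /=; rewrite ?h1 ?(negbTE h0).
  - have q2 : 1 - 1 / 2 = 1 / 2 :> R by lra.
    by move: df dt; rewrite q2 => df dt [].
(* Two almost sure limits agree at some common sample point, since the space has positive
   measure. *)
apply: xget_unique => // m' cvg'.
have P0 : (0 < P [set: T])%E by rewrite probability_setT.
have := ae_properfilter_algebraOfSetsType P0 => PF.
have [t [ht ht']] := filter_ex (filterI cvg_ae cvg').
exact: (cvg_unique _ ht' ht).
Qed.

End rate_of_profit.

Unset Implicit Arguments.

Theorem corollary6 (R : realType) (d : nat -> measure_display)
    (T : forall r : nat, measurableType (d r))
    (P : forall r : nat, probability (T r) R)
    (heads : forall r : nat, coin -> nat -> set (T r))
    (x0 : nat -> int)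
    (tosses : forall r : nat, (3 <= r)%N ->
       independent_tosses (P r) r (0 : R) (heads r))
    (even_start : forall r : nat, (3 <= r)%N -> ~~ odd r -> (2 %| x0 r)%Z) :
  let mu := fun r : nat =>
    rate_of_profit (P r) r (heads r) (pattern (s_ r) r) (x0 r) in
  (fun r : nat => (1 - mu r) / ((2 * s_ r)%:R / r%:R)) @ \oo --> (1 : R).
Proof.
move=> mu; apply: cvg_trans (@rate_asymptotics R).
apply: near_eq_cvg; exists 3%N => // r /= r3.
rewrite /mu (rate_of_profitE r3 (tosses r r3))//; last exact: even_start.
have lr : (0 < trunc_log 2 r)%N by apply: trunc_log_max; rewrite // ltnW.
have rl : (2 ^ trunc_log 2 r <= r)%N by apply: trunc_logP => //; lia.
rewrite /s_; move: lr rl; case: (trunc_log 2 r) => // n _; rewrite subn1 /=.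
(* Here n = s_r, and n < 2^n gives 2n < 2^(n + 1) <= r. *)
have := ltn_expl n (isT : (1 < 2)%N); rewrite expnS; lia.
Qed.
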